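(* Let $\{a_0,a_1,\ldots\}$ and $\{b_1,b_2,\ldots\}$ be complex sequences with all $a_i\neq 0$, and let $T\in\mathbb{N}$. The connecting operator $C^T:\mathcal{F}^T\to\mathcal{F}^T$ is an isomorphism of $\mathcal{F}^T$, and it admits the representation in terms of the response vector: the matrix of $C^T$ (in the standard basis, rows and columns numbered $1,\ldots,T$) has entries $$\{C^T\}_{ij}=a_0\sum_{k=0}^{T-\max\{i,j\}} r_{|i-j|+2k},\qquad i,j=1,\ldots,T,\qquad r_0=a_0 .$$
   Context: $\mathbb{N}=\{1,2,\ldots\}$. For a complex sequence (control) $f=(f_0,f_1,\ldots)$ let $u^f_{n,t}$ be the solution of $$\begin{cases} u_{n,t+1}+u_{n,t-1}-a_n u_{n+1,t}-a_{n-1}u_{n-1,t}-b_n u_{n,t}=0,& n\in\mathbb{N},\ t\in\mathbb{N}\cup\{0\},\\ u_{n,-1}=u_{n,0}=0,& n\in\mathbb{N},\\ u_{0,t}=f_t,& t\in\mathbb{N}\cup\{0\},\end{cases}$$ and let $v^f_{n,t}$ be the solution of the auxiliary system obtained by replacing all $a_n,b_n$ by their complex conjugates $\overline{a_n},\overline{b_n}$ (with the same initial conditions and $v_{0,t}=f_t$). Outer space: $\mathcal{F}^T=\mathbb{C}^T$ with elements $f=(f_0,\ldots,f_{T-1})$ and $(f,g)_{\mathcal{F}^T}=\sum_{k=0}^{T-1}f_k\overline{g_k}$. Inner space: $\mathcal{H}^T=\mathbb{C}^T$ with elements $h=(h_1,\ldots,h_T)$ and $(h,l)_{\mathcal{H}^T}=\sum_{k=1}^T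 h_k\overline{l_k}$. For $f\in\mathcal{F}^T$ and $n\geq 1$, $t\leq T$, the values $u^f_{n,t}$, $v^f_{n,t}$ depend only on $f_0,\ldots,f_{T-1}$. Control operators $W^T,W^T_\#:\mathcal{F}^T\to\mathcal{H}^T$: $(W^Tf)_n=u^f_{n,T}$, $(W^T_\# f)_n=v^f_{n,T}$, $n=1,\ldots,T$. The connecting operator $C^T:\mathcal{F}^T\to\mathcal{F}^T$ is defined by $$(C^Tf,g)_{\mathcal{F}^T}=(W^Tf,W^T_\# g)_{\mathcal{H}^T}=\sum_{k=1}^T u^f_{k,T}\overline{v^g_{k,T}}\qquad\text{for all } f,g\in\mathcal{F}^T.$$ The response vector is $r_k=u^\delta_{1,k+1}$, $k=0,1,2,\ldots$, where $\delta=(1,0,0,\ldots)$. *)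

(* Defs.v *)
From HB Require Import structures.
From mathcomp Require Import all_boot all_order all_algebra.
From mathcomp Require Import reals complex ring.

Set Implicit Arguments.
Unset Strict Implicit.
Unset Printing Implicit Defensive.

Import Order.TTheory GRing.Theory Num.Theory.
Local Open Scope ring_scope.

(* Times are integers, so that the initial layer t = -1 is literal. The
   coefficient b 0 is never used: the recurrence is imposed for n >= 1 only. *)
Definition is_solution (R : realType) (a b : nat -> R[i]) (f : nat -> R[i])
    (u : nat -> int -> R[i]) : Prop :=
  [/\ forall (n t : nat), (0 < n)%N ->
        u n (t%:Z + 1) + u n (t%:Z - 1) - a n * u n.+1 t%:Z
          - a n.-1 * u n.-1 t%:Z - b n * u n t%:Z = 0,
      forall n : nat, (0 < n)%N -> u n (-1) = 0 /\ u n 0 = 0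
    & forall t : nat, u 0%N t%:Z = f t].

(* The two consecutive layers (u _ (t - 1), u _ t). *)
Fixpoint layers (R : realType) (a b : nat -> R[i]) (f : nat -> R[i])
    (t : nat) : (nat -> R[i]) * (nat -> R[i]) :=
  if t is t'.+1 then
    let: (p, q) := layers a b f t' in
    (q, fun n => if n is n'.+1 then
                   a n * q n.+1 + a n' * q n' + b n * q n - p n
                 else f t)
  else (fun=> 0, fun n => if n is _.+1 then 0 else f 0%N).

Definition solution (R : realType) (a b : nat -> R[i]) (f : nat -> R[i])
    (n : nat) (t : int) : R[i] :=
  if t is Posz t' then (layers a b f t').2 n else 0.

Lemma layers1S (R : realType) (a b f : nat -> R[i]) t :
  (layers a b f t.+1).1 = (layers a b f t).2.
Proof. by rewrite /=; case: (layers a b f t). Qed.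

Lemma layers2S (R : realType) (a b f : nat -> R[i]) t n :
  (layers a b f t.+1).2 n.+1 =
    a n.+1 * (layers a b f t).2 n.+2 + a n * (layers a b f t).2 n
    + b n.+1 * (layers a b f t).2 n.+1 - (layers a b f t).1 n.+1.
Proof. by rewrite /=; case: (layers a b f t). Qed.

Lemma layers20 (R : realType) (a b f : nat -> R[i]) t :
  (layers a b f t).2 0%N = f t.
Proof. by case: t => [|t] //=; case: (layers a b f t). Qed.

Lemma layers1E (R : realType) (a b f : nat -> R[i]) t n :
  (layers a b f t).1 n = solution a b f n (t%:Z - 1).
Proof.
case: t => [|t]; first by rewrite sub0r.
by rewrite layers1S intS addrC addKr.
Qed.

Lemma solutionP (R : realType) (a b f : nat -> R[i]) :
  is_solution a b f (solution a b f).
Proof.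
split=> [[|n] t // _|[|n] //|t]; last exact: layers20.
rewrite -layers1E [t%:Z + 1]addrC -intS /solution layers2S [n.+1.-1]/=.
by ring.
Qed.

(* u 0 (-1) does not enter the system. *)
Lemma solution_unique (R : realType) (a b f : nat -> R[i]) u n (t : int) :
  is_solution a b f u -> -1 <= t -> (0 < n)%N || (0 <= t) ->
  u n t = solution a b f n t.
Proof.
move=> [rec init bnd].
have key k : forall m, u m k%:Z = (layers a b f k).2 m /\
                 ((0 < m)%N -> u m (k%:Z - 1) = (layers a b f k).1 m).
  elim: k => [|k IH] [|m]; rewrite ?layers20 ?bnd; split=> //.
  - by case: (init m.+1 isT).
  - by move=> _; rewrite sub0r; case: (init m.+1 isT).
  - have := rec m.+1 k isT; rewrite [k%:Z + 1]addrC -intS layers2S /=.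
    rewrite (IH m.+2).1 (IH m).1 (IH m.+1).1 (IH m.+1).2 // => H.
    by apply/eqP; rewrite -subr_eq0 -H; apply/eqP; ring.
  - by move=> _; rewrite layers1S intS addrC addKr (IH m.+1).1.
case: t => [t _ _|[|t] // _]; first exact: (key t n).1.
rewrite orbF => n0; by case: (init n n0).
Qed.

(* A control in C^T, with components f_0, ..., f_(T-1), extended by zero; by
   causality the extension does not affect u n t for n >= 1 and t <= T. *)
Definition control (R : realType) (T : nat) (f : 'cV[R[i]]_T) (t : nat) : R[i] :=
  if insub t is Some k then f k 0 else 0.

Definition conj_seq (R : realType) (a : nat -> R[i]) (n : nat) : R[i] :=
  Num.conj (a n).

(* The component of index k : 'I_T stands for the component h_(k+1) of the
   inner space. *)
Definition control_op (R : realType) (a b : nat -> R[i]) (T : nat)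
    (f : 'cV[R[i]]_T) : 'cV[R[i]]_T :=
  \col_(k < T) solution a b (control f) k.+1 T%:Z.

Definition control_op_aux (R : realType) (a b : nat -> R[i]) (T : nat)
    (f : 'cV[R[i]]_T) : 'cV[R[i]]_T :=
  control_op (conj_seq a) (conj_seq b) f.

Definition inner (R : realType) (T : nat) (f g : 'cV[R[i]]_T) : R[i] :=
  \sum_(k < T) f k 0 * Num.conj (g k 0).

Definition is_connecting_op (R : realType) (a b : nat -> R[i]) (T : nat)
    (CT : 'cV[R[i]]_T -> 'cV[R[i]]_T) : Prop :=
  forall f g : 'cV[R[i]]_T,
    inner (CT f) g = inner (control_op a b f) (control_op_aux a b g).

Definition response (R : realType) (a b : nat -> R[i]) (k : nat) : R[i] :=
  solution a b (fun t => (t == 0%N)%:R) 1 (k.+1)%:Z.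

Definition is_isomorphism (R : realType) (T : nat)
    (A : 'cV[R[i]]_T -> 'cV[R[i]]_T) : Prop :=
  linear A /\ bijective A.

Definition std_matrix (R : realType) (T : nat)
    (A : 'cV[R[i]]_T -> 'cV[R[i]]_T) : 'M[R[i]]_T :=
  \matrix_(i < T, j < T) A (delta_mx j 0) i 0.

Lemma layers_linear (R : realType) (a b f g h : nat -> R[i]) c t :
  (forall s, h s = c * f s + g s) ->
  (forall n, (layers a b h t).1 n = c * (layers a b f t).1 n + (layers a b g t).1 n)
  /\ (forall n, (layers a b h t).2 n = c * (layers a b f t).2 n + (layers a b g t).2 n).
Proof.
move=> hE; elim: t => [|t [IH1 IH2]].
  by split=> [n|[|n]] /=; rewrite ?mulr0 ?addr0.
split=> [n|[|n]]; rewrite ?layers1S ?layers20 ?layers2S //.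
rewrite !IH1 !IH2; ring.
Qed.

Lemma control_op_linear (R : realType) (a b : nat -> R[i]) (T : nat) :
  linear (@control_op R a b T).
Proof.
move=> c f g; apply/colP => k; rewrite !mxE /solution.
apply: (layers_linear _ _ _ _).2 => s.
rewrite /control; case: insubP => [j _ _|_]; by rewrite ?mxE ?mulr0 ?addr0.
Qed.

Lemma connecting_op_exists (R : realType) (a b : nat -> R[i]) (T : nat) :
  exists CT : 'cV[R[i]]_T -> 'cV[R[i]]_T, is_connecting_op a b CT.
Proof.
pose V := @control_op_aux R a b T.
have Vlin : linear V by exact: control_op_linear.
exists (fun f => \col_i inner (control_op a b f) (V (delta_mx i 0))) => f g.
pose VL := GRing.isLinear.Build _ _ _ _ V Vlin.
pose VH : {linear 'cV[R[i]]_T -> 'cV[R[i]]_T} := HB.pack V VL.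
have VE : V g = \sum_i g i 0 *: V (delta_mx i 0).
  rewrite -[V]/(VH : _ -> _) {1}[g]matrix_sum_delta linear_sum.
  by apply: eq_bigr => i _; rewrite big_ord1 linearZ.
rewrite -/(V g) VE /inner.
under eq_bigr do rewrite mxE mulr_suml.
rewrite exchange_big; apply: eq_bigr => k _ /=.
rewrite summxE rmorph_sum mulr_sumr; apply: eq_bigr => i _.
by rewrite !mxE rmorphM mulrAC -mulrA.
Qed.

Lemma connecting_op_unique (R : realType) (a b : nat -> R[i]) (T : nat)
    (CT CT' : 'cV[R[i]]_T -> 'cV[R[i]]_T) :
  is_connecting_op a b CT -> is_connecting_op a b CT' -> CT =1 CT'.
Proof.
move=> H H' f; apply/colP => i.
have E (A : 'cV[R[i]]_T) : inner A (delta_mx i 0) = A i 0.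
  rewrite /inner (bigD1 i) //= mxE !eqxx rmorph1 mulr1 big1 ?addr0 // => k ki.
  by rewrite mxE (negbTE ki) rmorph0 mulr0.
by rewrite -!E H H'.
Qed.

(* Main.v *)
From HB Require Import structures.
Require Import Defs.
From mathcomp Require Import all_boot all_order all_algebra.
From mathcomp Require Import perm reals complex ring zify.

Import GRing.Theory Num.Theory.
Local Open Scope ring_scope.

(** Write [U n t] for the solution driven by the impulse [delta]. Time
    invariance and the fact that the auxiliary system is the conjugate of the
    original one give [C_ij = \sum_(k >= 1) U k (T - i) * U k (T - j)] for
    [i, j = 0, ..., T - 1]. These sums [S s t] satisfy
    the discrete wave equation
    [S (s+1) t + S (s-1) t = S s (t+1) + S s (t-1)] for [s, t >= 1], by
    summation by parts, with [S 0 t = 0] and [S 1 t = a_0 * U 1 t]; solving it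
    in the direction of [s] gives the formula. Since [U n t = 0] for [n > t]
    and [U n n = a_0 ... a_(n-1) != 0], the matrix [C^T] is [X^T X] with [X] a
    column permutation of an invertible triangular matrix. *)

Section Impulse.

Set Implicit Arguments.
Unset Strict Implicit.

Variables (R : realType) (a b : nat -> R[i]).

(** * Invariances of the system: delay and conjugation *)

Lemma layers_ext (f g : nat -> R[i]) t n :
  f =1 g -> (layers a b f t).2 n = (layers a b g t).2 n.
Proof.
(* Linearity is applied to [f = 0 * f + g]. *)
move=> fg; have [|_ ->] := @layers_linear R a b f g f 0 t.
  by move=> s; rewrite mul0r add0r.
by rewrite mul0r add0r.
Qed.

(** Since [g 0 = 0], the layer of [g] at time 0 vanishes identically, so at time 1 [g] has the data
    that [f] has at time 0. *)
Lemma layers_delay (f g : nat -> R[i]) t :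
  g 0%N = 0 -> (forall s, g s.+1 = f s) ->
  (layers a b g t.+1).1 =1 (layers a b f t).1 /\
  (layers a b g t.+1).2 =1 (layers a b f t).2.
Proof.
move=> g0 gS; elim: t => [|t [IH1 IH2]].
  split=> [[|n]|[|n]]; rewrite ?layers1S ?layers20 ?layers2S ?gS //=.
  by case: n => [|n]; rewrite ?g0 !mulr0 !addr0 subr0.
split=> n; first by rewrite layers1S IH2 layers1S.
case: n => [|n]; first by rewrite !layers20.
by rewrite layers2S [RHS]layers2S !IH2 IH1.
Qed.

Lemma layers_conj (f g : nat -> R[i]) t :
  (forall s, g s = Num.conj (f s)) ->
  (forall n, (layers (conj_seq a) (conj_seq b) g t).1 n
             = Num.conj ((layers a b f t).1 n)) /\
  (forall n, (layers (conj_seq a) (conj_seq b) g t).2 n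
             = Num.conj ((layers a b f t).2 n)).
Proof.
move=> gE; elim: t => [|t [IH1 IH2]].
  by split=> [n|[|n]] /=; rewrite ?rmorph0.
split=> [n|[|n]]; rewrite ?layers1S ?layers20 ?layers2S //.
by rewrite !IH1 !IH2 /conj_seq !(rmorphB, rmorphD, rmorphM).
Qed.

(** * The impulse solution: recurrences, causality, diagonal values *)

Definition impulse (n t : nat) : R[i] :=
  (layers a b (fun s => (s == 0%N)%:R) t).2 n.

Local Notation U := impulse.

Lemma layers_delayed_impulse (f : nat -> R[i]) j t n :
  (forall s, f s = (s == j)%:R) -> (layers a b f (t + j)%N).2 n = U n t.
Proof.
elim: j f => [|j IH] f fE; first by rewrite addn0; apply: layers_ext.
rewrite addnS (@layers_delay (fun s => (s == j)%:R) f _ _ _).2 ?fE //.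
by apply: IH.
Qed.

Lemma impulse_boundary t : U 0 t.+1 = 0.
Proof. by rewrite /U layers20. Qed.

Lemma impulse_init n : U n.+1 0 = 0.
Proof. by []. Qed.

Lemma impulse_rec1 n : U n.+1 1 = a n * U n 0.
Proof. by rewrite /U layers2S /=; ring. Qed.

Lemma impulse_rec n t :
  U n.+1 t.+2 = a n.+1 * U n.+2 t.+1 + a n * U n t.+1 + b n.+1 * U n.+1 t.+1
                - U n.+1 t.
Proof. by rewrite {1}/U layers2S layers1S. Qed.

Lemma impulse_causal n t : (t < n)%N -> U n t = 0.
Proof.
elim/ltn_ind: t n => -[|[|t]] IH [|n] // tn.
  by rewrite impulse_rec1; case: n tn => // n _; rewrite impulse_init mulr0.
rewrite impulse_rec !IH; try lia; ring.
Qed.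

Lemma impulse_diag n : U n n = \prod_(k < n) a k.
Proof.
elim: n => [|[|n] IH]; first by rewrite big_ord0.
  by rewrite impulse_rec1 big_ord_recr big_ord0 /= mul1r mulr1.
rewrite impulse_rec IH !impulse_causal; try lia.
by rewrite [in RHS]big_ord_recr /=; ring.
Qed.

(** * Gram sums of the impulse solution and their wave equation *)

Definition impulse_gram N s t := \sum_(k < N) U k.+1 s * U k.+1 t.

Local Notation S := impulse_gram.

Lemma impulse_gram0 N t : S N 0 t = 0.
Proof. by apply: big1 => k _; rewrite impulse_init mul0r. Qed.

Lemma impulse_gram1 N t : (0 < N)%N -> S N 1 t = a 0%N * U 1 t.
Proof.
case: N => // N _; rewrite /S big_ord_recl big1 /= => [|k _].
  by rewrite addr0 impulse_rec1 mulr1.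
by rewrite impulse_causal ?mul0r.
Qed.

(** Discrete Green identity: the potential terms [b] cancel and the sum telescopes to the flux at
    the right end. The flux at the left end is zero because [U 0] vanishes at positive times. *)
Lemma impulse_gram_green N s t :
  S N s.+2 t.+1 + S N s t.+1 - S N s.+1 t.+2 - S N s.+1 t =
  a N * (U N.+1 s.+1 * U N t.+1 - U N s.+1 * U N.+1 t.+1).
Proof.
elim: N => [|N]; first by rewrite /S !big_ord0 !impulse_boundary; ring.
rewrite /S !big_ord_recr /= -!/(S _ _ _) => IH.
rewrite (impulse_rec N s) (impulse_rec N t).
(* The new summand is the difference of the fluxes at [N.+1] and [N]; the induction hypothesis
   cancels the first line against the flux at [N]. *)
transitivity ((S N s.+2 t.+1 + S N s t.+1 - S N s.+1 t.+2 - S N s.+1 t)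
  - a N * (U N.+1 s.+1 * U N t.+1 - U N s.+1 * U N.+1 t.+1)
  + a N.+1 * (U N.+2 s.+1 * U N.+1 t.+1 - U N.+1 s.+1 * U N.+2 t.+1)).
  ring.
by rewrite IH; ring.
Qed.

(** Both times [s.+1] and [t.+1] are at most [N], so by causality the signal has not reached [N.+1]
    and the flux is zero. *)
Lemma impulse_gram_wave N s t : (s < N)%N -> (t < N)%N ->
  S N s.+2 t.+1 = S N s.+1 t.+2 + S N s.+1 t - S N s t.+1.
Proof.
move=> sN tN; have := impulse_gram_green N s t.
rewrite !(@impulse_causal N.+1) // mulr0 mul0r subr0 mulr0 => /eqP.
by rewrite -addrA -opprD subr_eq0 => /eqP <-; rewrite addrK.
Qed.

(** Marching in [s] never increases the sum of the two times, so bounding it by [N] keeps the wave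
    equation available at every step. *)
Lemma impulse_gram_wide N s d : (s + (s + d) <= N)%N ->
  S N s (s + d) = a 0%N * \sum_(k < s) U 1 (d + 2 * k).+1.
Proof.
elim/ltn_ind: s d => -[|[|s]] IH d sN.
- by rewrite impulse_gram0 big_ord0 mulr0.
- by rewrite impulse_gram1 ?big_ord1 /= ?muln0 ?addn0 //; lia.
rewrite [(s.+2 + d)%N]addSn impulse_gram_wave; try lia.
rewrite (_ : (s.+1 + d).+2 = s.+1 + d.+2)%N; last lia.
rewrite (_ : (s.+1 + d).+1 = s + d.+2)%N; last lia.
rewrite !IH; try lia.
(* The gap [d.+2] occurs with [s.+1] and with [s] terms; their difference is one term, the last one
   of the sum for the gap [d]. *)
rewrite (big_ord_recr s) [in RHS]big_ord_recr /=.
rewrite (_ : (d + 2 * s.+1) = d.+2 + 2 * s)%N; last lia.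
ring.
Qed.

Lemma impulse_gram_trunc N T s t : (T <= N)%N -> (s <= T)%N ->
  S N s t = S T s t.
Proof.
move=> TN sT; rewrite -(subnKC TN) /S big_split_ord /= [X in _ + X]big1 ?addr0 //.
by move=> k _; rewrite impulse_causal ?mul0r //=; lia.
Qed.

Lemma impulse_gram_sym N s t : S N s t = S N t s.
Proof. by apply: eq_bigr => k _; rewrite mulrC. Qed.

Lemma impulse_gramE T s t : (s <= t)%N -> (s <= T)%N ->
  S T s t = a 0%N * \sum_(k < s) U 1 (t - s + 2 * k).+1.
Proof.
(* The march passes through times beyond [T], so the sum is first widened by terms that vanish by
   causality. *)
move=> st sT; rewrite -(@impulse_gram_trunc (T + (s + t))) //; last lia.
have := @impulse_gram_wide (T + (s + t)) s (t - s).
by rewrite subnKC // leq_addl; apply.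
Qed.

(** * Matrices of the control and connecting operators *)

Lemma control_delta T (j : 'I_T) s :
  @control R T (delta_mx j 0) s = (s == j)%:R.
Proof.
rewrite /control; case: insubP => [k _ <-|]; first by rewrite mxE andbT.
by rewrite -leqNgt => Ts; case: eqP => // sj; move: (ltn_ord j); lia.
Qed.

Lemma control_op_delta T (j k : 'I_T) :
  control_op a b (delta_mx j 0) k 0 = U k.+1 (T - j).
Proof.
rewrite mxE /solution.
have := @layers_delayed_impulse (control (delta_mx j 0)) j (T - j) k.+1.
by rewrite subnK ?(ltnW (ltn_ord j)) //; apply=> s; rewrite control_delta.
Qed.

Lemma control_op_aux_delta T (j k : 'I_T) :
  control_op_aux a b (delta_mx j 0) k 0 =
  Num.conj (control_op a b (delta_mx j 0) k 0).
Proof.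
rewrite !mxE; apply: (layers_conj _ _).2 => s.
by rewrite control_delta rmorph_nat.
Qed.

Definition control_mx T : 'M[R[i]]_T := \matrix_(k, j) U k.+1 (T - j).

Lemma control_opE T (f : 'cV_T) : control_op a b f = control_mx T *m f.
Proof.
pose W : {linear 'cV[R[i]]_T -> 'cV[R[i]]_T} :=
  HB.pack (@control_op R a b T)
    (GRing.isLinear.Build _ _ _ _ _ (@control_op_linear R a b T)).
rewrite -[control_op a b f]/(W f) {1}[f]matrix_sum_delta linear_sum.
apply/colP => k; rewrite summxE mxE; apply: eq_bigr => j _.
by rewrite big_ord1 linearZ !mxE -control_op_delta mxE mulrC.
Qed.

Lemma control_mx_unit T : (forall n, a n != 0) -> control_mx T \in unitmx.
Proof.
move=> a0; pose Y : 'M[R[i]]_T := \matrix_(j, k) U k.+1 j.+1.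
have trigY : is_trig_mx Y.
  by apply/is_trig_mxP => j k jk; rewrite mxE impulse_causal.
have unitY : Y \in unitmx.
  rewrite unitmxE det_trig // unitfE; apply/prodf_neq0 => k _.
  by rewrite mxE impulse_diag; apply/prodf_neq0.
(* Row [rev_ord j] of [Y] is taken at time [(T - j.+1).+1 = T - j]. *)
have -> : control_mx T = col_perm (perm (@rev_ord_inj T)) Y^T.
  apply/matrixP => k j; rewrite !mxE permE /=.
  by congr impulse; move: (ltn_ord j); lia.
by rewrite col_permE unitmx_mul unitmx_tr unitY unitmx_perm.
Qed.

Lemma inner_delta T (f : 'cV[R[i]]_T) i : inner f (delta_mx i 0) = f i 0.
Proof.
rewrite /inner (bigD1 i) //= mxE !eqxx rmorph1 mulr1 big1 ?addr0 // => k ki.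
by rewrite mxE (negbTE ki) rmorph0 mulr0.
Qed.

(** The conjugation in the inner product undoes that of the auxiliary system, which leaves a
    transpose in place of an adjoint. *)
Lemma connecting_opE T (CT : 'cV[R[i]]_T -> 'cV[R[i]]_T) f :
  is_connecting_op a b CT -> CT f = (control_mx T)^T *m control_mx T *m f.
Proof.
move=> hCT; apply/colP => i; rewrite -inner_delta hCT -mulmxA mxE.
rewrite control_opE; apply: eq_bigr => k _.
by rewrite control_op_aux_delta conjCK control_op_delta !mxE mulrC.
Qed.

Lemma std_matrix_connecting_op T (CT : 'cV[R[i]]_T -> 'cV[R[i]]_T) i j :
  is_connecting_op a b CT -> std_matrix CT i j = S T (T - i) (T - j).
Proof.
move=> hCT; rewrite mxE (connecting_opE _ hCT) -colE !mxE.
by apply: eq_bigr => k _; rewrite !mxE.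
Qed.

Lemma connecting_op_isomorphism T (CT : 'cV[R[i]]_T -> 'cV[R[i]]_T) :
  (forall n, a n != 0) -> is_connecting_op a b CT -> is_isomorphism CT.
Proof.
move=> a0 hCT; pose M := (control_mx T)^T *m control_mx T.
have CTE f : CT f = M *m f by exact: connecting_opE.
have unitM : M \in unitmx by rewrite unitmx_mul unitmx_tr control_mx_unit.
split=> [c f g|]; first by rewrite !CTE mulmxDr scalemxAr.
by exists (mulmx (invmx M)) => f; rewrite !CTE ?mulKmx ?mulKVmx.
Qed.

End Impulse.

Theorem theorem1 (R : realType) (a b : nat -> R[i]) (ha : forall n : nat, a n != 0)
    (T : nat) (hT : (0 < T)%N)
    (CT : 'cV[R[i]]_T -> 'cV[R[i]]_T) (hCT : is_connecting_op a b CT) :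
  [/\ is_isomorphism CT,
      forall i j : 'I_T,
        std_matrix CT i j =
          a 0%N * \sum_(0 <= k < (T - maxn i.+1 j.+1).+1)
                     response a b (`|(i%:Z - j%:Z)%R|%N + 2 * k)%N
    & response a b 0 = a 0%N].
Proof.
split; first exact: connecting_op_isomorphism hCT.
  move=> i j; rewrite (std_matrix_connecting_op _ _ hCT) big_mkord.
  have [ltiT ltjT] := (ltn_ord i, ltn_ord j).
  (* By symmetry [T - i] may be taken as the smaller time; it is then the number of terms in the
     sum. *)
  wlog ji : i j ltiT ltjT / (j <= i)%N => [gen|].
    case: (leqP j i) => [|/ltnW] ij; first exact: gen.
    by rewrite impulse_gram_sym gen // maxnC distnC.
  rewrite impulse_gramE ?leq_sub2l ?leq_subr //.
  rewrite (_ : (T - maxn i.+1 j.+1).+1 = T - i)%N; last lia.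
  congr (_ * _); apply: eq_bigr => k _; rewrite -[RHS]/(impulse a b 1 _).
  by congr impulse; lia.
by rewrite -[LHS]/(impulse a b 1 1) impulse_rec1 mulr1.
Qed.
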